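(* Let $l\ge 1$ and $n\ge 2$ be integers and let $\mathcal A=\{a_1<a_2<\dots<a_l\}$ be a totally ordered alphabet. Let $\mathcal M$ be the set of all words over $\mathcal A$ that are not $n$-divisible, and let $Y$ be the set of all nonempty words over $\mathcal A$ of length less than $n$. Then the height of $\mathcal M$ over $Y$ is at most $$\Phi(n,l)=2^{96}\, l\, n^{12\log_3 n+36\log_3\log_3 n+91}.$$
   Context: Words are finite sequences of letters; a subword means a contiguous factor. Two words $u,v$ are called comparable if neither is a prefix of the other (in particular equal words are not comparable). For comparable $u,v$ write $u\succ v$ if at the first position where $u$ and $v$ differ the letter of $u$ is larger. A word $W$ is $n$-divisible if it contains a subword of the form $u_1u_2\cdots u_n$ with nonempty words $u_i$ satisfying $u_1\succ u_2\succ\dots\succ u_n$. The height of a set of words $\mathcal M$ over a set of words $Y$ is the least integer $h$ such that every word of $\mathcal M$ can be written as $y_1^{k_1}y_2^{k_2}\cdots y_r^{k_r}$ with $y_i\in Y$, $k_i\ge 1$ integers and $r\le h$. *)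

(* Defs.v *)
(* words are lists of nat; the alphabet {a_1<...<a_l} is
   {0,...,l-1} with the usual order on nat. *)
From Stdlib Require Import Reals List Arith.
Import ListNotations.
Open Scope R_scope.

Definition word_over (l : nat) (w : list nat) : Prop :=
  Forall (fun a => (a < l)%nat) w.

Definition is_prefix (u v : list nat) : Prop := exists w, v = u ++ w.

Definition comparable (u v : list nat) : Prop :=
  ~ is_prefix u v /\ ~ is_prefix v u.

Definition succ_word (u v : list nat) : Prop :=
  comparable u v /\
  exists (p : list nat) (a b : nat) (s t : list nat),
    u = p ++ a :: s /\ v = p ++ b :: t /\ (b < a)%nat.

Fixpoint desc_chain (us : list (list nat)) : Prop :=
  match us with
  | u :: ((v :: _) as r) => succ_word u v /\ desc_chain r
  | _ => True
  end.

Definition n_divisible (n : nat) (W : list nat) : Prop :=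
  exists (x z : list nat) (us : list (list nat)),
    length us = n /\ Forall (fun u => u <> []) us /\ desc_chain us /\
    W = x ++ concat us ++ z.

Definition wpow (y : list nat) (k : nat) : list nat := concat (repeat y k).

Definition representable (Y : list nat -> Prop) (h : nat) (w : list nat) : Prop :=
  exists ps : list (list nat * nat),
    (length ps <= h)%nat /\
    Forall (fun p => Y (fst p) /\ (1 <= snd p)%nat) ps /\
    w = concat (map (fun p => wpow (fst p) (snd p)) ps).

(* "height of M over Y is at most B": the least h such that every word of M is
   representable with at most h factors is <= B, i.e. some h <= B works. *)
Definition height_at_most (M Y : list nat -> Prop) (B : R) : Prop :=
  exists h : nat, INR h <= B /\ forall w, M w -> representable Y h w.

Definition log3 (x : R) : R := ln x / ln 3.

Definition Phi (n l : nat) : R :=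
  2 ^ 96 * INR l *
  Rpower (INR n) (12 * log3 (INR n) + 36 * log3 (log3 (INR n)) + 91).

Definition M_set (n l : nat) (w : list nat) : Prop :=
  word_over l w /\ ~ n_divisible n w.

Definition Y_set (n l : nat) (w : list nat) : Prop :=
  word_over l w /\ w <> [] /\ (length w < n)%nat.

(* Main.v *)
Require Import Defs.
From Stdlib Require Import Reals List Arith Lra Lia.
From mathcomp Require all_boot zify.

(** Let K = 2^m with 3n <= K <= 6n and let W be a word that is not n-divisible.
Colour a position i by its residue modulo K together with the length of the
longest chain of positions in that residue class that ends at i and along which
the factors of length K decrease.  Chains are shorter than n, so there are at
most N = nK colours, and inside a colour the factors of length K never decrease
(the Dilworth-type argument of Latyshev).

Let T(a) be the number of pairs (colour of i, factor of length a at i).  Then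
T(1) <= N l.  Between two consecutive first occurrences of such pairs the factor
of length a is a function of the colour, so the factor of length 2a at i is
determined by the colours of i and i + a; hence T(2a) + 1 <= (N^2 + a)(T(a) + 1),
and T(K) is at most l times a quasi-polynomial in n.

If no p < n is a period of the last K - n letters of a factor u of length K, the
first n suffixes of u are pairwise comparable, and n disjoint copies of u would
yield an n-division by taking these suffixes in decreasing order, one in each copy.
So there are at most n (T(K) + 1) positions whose window of length K - n has no
period below n.  Reading W from the left, a letter at such a position and a maximal
run with period below n elsewhere, costs at most one factor per such position,
because the window that ends just where a run breaks has no period below n. *)

Module Words.
Import all_boot zify.
Set Implicit Arguments.
Unset Strict Implicit.
Unset Printing Implicit Defensive.
Local Open Scope nat_scope.
Local Open Scope seq_scope.

(** * Lexicographic comparison of words *)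

Lemma app_cat (T : Type) (s t : seq T) : app s t = cat s t.
Proof. by []. Qed.

(** Boolean counterpart of [succ_word]: it turns false once either word runs out, so truth already
    includes comparability. *)
Fixpoint gtw (u v : seq nat) : bool :=
  match u, v with
  | x :: u', y :: v' => (y < x) || ((x == y) && gtw u' v')
  | _, _ => false
  end.

Lemma gtw_cat u v s t : gtw u v -> gtw (u ++ s) (v ++ t).
Proof.
elim: u v => [|x u IH] [|y v] //= /orP[->//|/andP[-> /IH ->]].
by rewrite orbT.
Qed.

Lemma gtw_asym u v : gtw u v -> ~~ gtw v u.
Proof.
elim: u v => [|x u IH] [|y v] //= /orP[h|/andP[/eqP -> /IH/negbTE ->]]; last first.
  by rewrite ltnn eqxx.
by rewrite negb_or -leqNgt (ltnW h) /= (ltn_eqF h).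
Qed.

Lemma gtw_nonnil u v : gtw u v -> u <> [::].
Proof. by case: u. Qed.

Lemma gtw_succ u v : gtw u v -> succ_word u v.
Proof.
move=> guv; split; first split.
- case=> w E; move: guv; rewrite E app_cat.
  by elim: u {E} => //= x u IH; rewrite ltnn eqxx.
- case=> w E; move: guv; rewrite E app_cat.
  by elim: v {E} => [|x v IH] /=; [case: w | rewrite ltnn eqxx].
elim: u v guv => [|x u IH] [|y v] //= /orP[h|/andP[/eqP <- /IH]].
  by exists [::], x, y, u, v; split=> //; split=> //; apply/ltP.
case=> p [a [b [s [t [-> [-> h]]]]]].
by exists (x :: p), a, b, s, t.
Qed.

(** * Factors of a word, and n-divisions built from decreasing factors *)

(** Words are read as functions, in practice [nth 0 W], so positions need no bound; beyond the end
    the letter is 0. *)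
Definition factor (w : nat -> nat) i a : seq nat := map w (iota i a).

Lemma size_factor w i a : size (factor w i a) = a.
Proof. by rewrite size_map size_iota. Qed.

Lemma factorD w i a b : factor w i (a + b) = factor w i a ++ factor w (i + a) b.
Proof. by rewrite /factor iotaD map_cat. Qed.

Lemma factor_widen w i a b : a <= b ->
  factor w i b = factor w i a ++ factor w (i + a) (b - a).
Proof. by move=> ab; rewrite -factorD subnKC. Qed.

Lemma factor_eqP w i j a :
  reflect (forall k, k < a -> w (i + k) = w (j + k))
          (factor w i a == factor w j a).
Proof.
apply: (iffP eqP) => [E k ka|E].
  have := congr1 (nth 0 ^~ k) E; rewrite /factor.
  by rewrite !(nth_map 0) ?size_iota // !nth_iota.
apply: (@eq_from_nth _ 0); rewrite !size_factor // => k ka.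
by rewrite /factor !(nth_map 0) ?size_iota // !nth_iota // E.
Qed.

Lemma gtw_factor w i j a b a' b' : a <= a' -> b <= b' ->
  gtw (factor w i a) (factor w j b) -> gtw (factor w i a') (factor w j b').
Proof.
by move=> aa bb; rewrite (factor_widen _ _ aa) (factor_widen _ _ bb); apply: gtw_cat.
Qed.

(** The lengths may differ: for two suffixes of one factor, the agreement obtained here is a
    period. *)
Lemma ngtw_factor w i j a b :
  ~~ gtw (factor w i a) (factor w j b) -> ~~ gtw (factor w j b) (factor w i a) ->
  forall k, k < a -> k < b -> w (i + k) = w (j + k).
Proof.
elim: a b i j => [|a IH] [|b] i j //=.
rewrite !negb_or -!leqNgt => /andP[le1 n1] /andP[le2 n2].
have E : w i = w j by apply/eqP; rewrite eqn_leq le1.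
move: n1 n2; rewrite E eqxx /= => n1 n2 [|k] ka kb; first by rewrite !addn0.
by rewrite -!addSnnS; apply: IH n1 n2 _ ka kb.
Qed.

Lemma ngtw_eq w i j a :
  ~~ gtw (factor w i a) (factor w j a) -> ~~ gtw (factor w j a) (factor w i a) ->
  factor w i a = factor w j a.
Proof. by move=> h1 h2; apply/eqP/factor_eqP => k ka; exact: (ngtw_factor h1 h2 ka ka). Qed.

(* [(s, k)] stands for the factor of length [k] at position [s]. *)
Definition drops (w : nat -> nat) (p q : nat * nat) : bool :=
  (p.1 + p.2 <= q.1) && gtw (factor w p.1 p.2) (factor w q.1 q.2).

(** Each block runs from the start of one factor to the start of the next, the last one up to [e].
    This fills the gaps and keeps the order, since the deciding letters lie inside the original
    factors. *)
Lemma path_drops_chain w e p ps : path (drops w) p ps ->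
  (last p ps).1 + (last p ps).2 <= e -> 0 < (last p ps).2 ->
  p.1 <= e /\
  exists us b, [/\ size us = size ps, p.1 + b <= e, p.2 <= b,
    List.Forall (fun u => u <> [::]) (factor w p.1 b :: us) &
    desc_chain (factor w p.1 b :: us) /\
    List.concat (factor w p.1 b :: us) = factor w p.1 (e - p.1)].
Proof.
elim: ps p => [|q ps IH] p /=.
  move=> _ le gt; split; first by lia.
  exists [::], (e - p.1); split=> //; try lia.
    apply: List.Forall_cons => //; case E: (e - p.1) => //; lia.
  by rewrite app_cat cats0.
case/andP=> /andP[pq g] pth le gt.
have [qe [us [b [sz qb bq F [dc cc]]]]] := IH _ pth le gt.
have g' : gtw (factor w p.1 (q.1 - p.1)) (factor w q.1 b).
  by apply: gtw_factor g => //; lia.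
split; first by lia.
exists (factor w q.1 b :: us), (q.1 - p.1); split=> //=; try lia.
- by apply: List.Forall_cons => //; apply: gtw_nonnil g'.
split; first by split=> //; apply: gtw_succ.
move: cc => /= ->; rewrite app_cat.
have -> : e - p.1 = (q.1 - p.1) + (e - q.1) by lia.
by rewrite factorD subnKC //; lia.
Qed.

Lemma drops_divisible W p ps n : path (drops (nth 0 W)) p ps ->
  size ps = n -> (last p ps).1 + (last p ps).2 <= size W -> 0 < (last p ps).2 ->
  n_divisible n.+1 W.
Proof.
move=> pth sz le gt.
have [pe [us [b [sz' pb bp F [dc cc]]]]] := path_drops_chain pth le gt.
exists (take p.1 W), [::], (factor (nth 0 W) p.1 b :: us); split=> //.
  by rewrite /= -sz -sz'.
split=> //; split=> //; rewrite cc !app_cat cats0.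
have -> : take p.1 W = factor (nth 0 W) 0 p.1 by rewrite /factor map_nth_iota0.
by rewrite -(factorD _ 0) subnKC // /factor map_nth_iota0 // take_size.
Qed.


(** * Decreasing chains in a residue class and the colouring *)

(** [m] counts drops, so the chain has [m + 1] positions including [i]. *)
Fixpoint chain (w : nat -> nat) K m i : bool :=
  if m is m'.+1 then
    has (fun j => [&& j == i %[mod K], gtw (factor w j K) (factor w i K) &
                      chain w K m' j]) (iota 0 i)
  else true.

(** This is why colours record residues: factors of length [K] in one class do not overlap. *)
Lemma eqmod_gap K i j : j < i -> j = i %[mod K] -> j + K <= i.
Proof.
move=> ji /esym/eqP; rewrite eqn_mod_dvd; last by lia.
by move/dvdn_leq; lia.
Qed.

Lemma chain_drops w K m i : chain w K m i ->
  exists p ps, [/\ size ps = m, path (drops w) p ps & last p ps = (i, K)].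
Proof.
elim: m i => [|m IH] i /=; first by exists (i, K), [::].
case/hasP=> j; rewrite mem_iota => /andP[_ ji] /and3P[/eqP E g /IH].
case=> p [ps [sz pth lst]]; exists p, (rcons ps (i, K)).
split; rewrite ?size_rcons ?sz ?last_rcons // rcons_path pth lst /drops /= g andbT.
exact: eqmod_gap.
Qed.

Lemma chainW w K m i : chain w K m.+1 i -> chain w K m i.
Proof.
elim: m i => [|m IH] i //.
rewrite [chain w K m.+2 i]/= => /hasP[j ji /and3P[E g /IH c]].
by apply/hasP; exists j => //; rewrite E g.
Qed.

Definition rank w K n i := \max_(m < n | chain w K m i) m.

(* The pair (rank, residue mod [K]) coded as one number below [n * K]. *)
Definition color w K n i := rank w K n i * K + i %% K.

Lemma chain_rank w K n i : 0 < n -> rank w K n i < n /\ chain w K (rank w K n i) i.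
Proof.
move=> n0; have := @eq_bigmax_cond _ [pred m : 'I_n | chain w K m i] (fun m => m).
case; first by apply/card_gt0P; exists (Ordinal n0).
by move=> m cm; rewrite /rank => ->.
Qed.

Lemma color_lt w K n i : 0 < K -> 0 < n -> color w K n i < n * K.
Proof.
move=> K0 n0; have [r _] := chain_rank w K i n0.
have := ltn_pmod i K0; rewrite /color.
have : (rank w K n i).+1 * K <= n * K by rewrite leq_mul2r r orbT.
by rewrite mulSn; lia.
Qed.

Lemma color_eq w K n i j : 0 < K -> color w K n i = color w K n j ->
  rank w K n i = rank w K n j /\ i = j %[mod K].
Proof.
move=> K0 E; have := congr1 (divn ^~ K) E; have := congr1 (modn ^~ K) E.
by rewrite /color !modnMDl !modn_mod !divnMDl // !divn_small ?ltn_pmod // !addn0.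
Qed.

(** A drop from [i] to [j] would prolong the longest chain at [i] and give [j] a larger rank. If
    that rank exceeded the cap in [rank], then [j] would end a chain with [n] drops. *)
Lemma color_mono w K n i j : 0 < K -> i < j -> ~~ chain w K n j ->
  color w K n.+1 i = color w K n.+1 j -> ~~ gtw (factor w i K) (factor w j K).
Proof.
move=> K0 ij nc /(color_eq K0)[er em]; apply/negP => g.
have [rn cr] := chain_rank w K i (ltn0Sn n).
have cj : chain w K (rank w K n.+1 i).+1 j.
  by apply/hasP; exists i; rewrite ?mem_iota // em eqxx g.
have rn' : (rank w K n.+1 i).+1 < n.+1.
  rewrite ltnS ltn_neqAle -ltnS rn andbT; apply: contra nc => /eqP E.
  by apply: chainW; rewrite -{1}E.
have := @leq_bigmax_cond _ [pred m : 'I_n.+1 | chain w K m j] (fun m => m) (Ordinal rn') cj.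
by rewrite -/(rank w K n.+1 j) -er ltnn.
Qed.

(** * First occurrences and the doubling recursion *)

(** The size is the number of distinct values of [f] below [M]; keeping positions instead of values
    lets them serve as cut points. *)
Definition firsts (T : eqType) (f : nat -> T) M :=
  [seq i <- iota 0 M | all (fun j => f j != f i) (iota 0 i)].

Lemma firsts_uniq (T : eqType) (f : nat -> T) M : uniq (firsts f M).
Proof. by rewrite filter_uniq // iota_uniq. Qed.

Lemma firstsP (T : eqType) (f : nat -> T) M i :
  reflect (i < M /\ forall j, j < i -> f j <> f i) (i \in firsts f M).
Proof.
rewrite mem_filter mem_iota /= add0n andbC.
apply: (iffP andP) => -[iM h]; split=> //.
  by move=> j ji; apply/eqP/(allP h); rewrite mem_iota.
by apply/allP => j; rewrite mem_iota => ji; apply/eqP/h.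
Qed.

Lemma firsts_rep (T : eqType) (f : nat -> T) M i : i < M ->
  exists d, [/\ d \in firsts f M, d <= i & f d = f i].
Proof.
elim/ltn_ind: i => i IH iM.
case: (boolP (i \in firsts f M)) => [|nf]; first by exists i.
have /hasP[j] : has (fun j => f j == f i) (iota 0 i).
  apply: contraNT nf => /hasPn h; apply/firstsP; split=> // j ji.
  by apply/eqP/h; rewrite mem_iota.
rewrite mem_iota => ji /eqP E.
have [|d [df dj Ed]] := IH _ ji; first by lia.
by exists d; split; rewrite ?Ed //; lia.
Qed.

(** The number T(a) is [size (firsts (key c w a) M)]. *)
Definition key (c w : nat -> nat) a i := (c i, factor w i a).

Definition monotone_on (c w : nat -> nat) K M := forall i j, i < j -> j < M ->
  c i = c j -> ~~ gtw (factor w i K) (factor w j K).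

Lemma monotone_le c w K M a : monotone_on c w K M -> a <= K -> monotone_on c w a M.
Proof.
move=> mono aK i j ij jM E; apply: contra (mono _ _ ij jM E).
exact: gtw_factor.
Qed.

(** The key of [j] first occurs at some [d] up to [i]. Along [d], [i], [j] the factors never
    decrease, and the outer two are equal. *)
Lemma constant_between_firsts c w M a i j : monotone_on c w a M ->
  i <= j -> j < M -> c i = c j ->
  (forall d, d \in firsts (key c w a) M -> d <= j -> d <= i) ->
  factor w i a = factor w j a.
Proof.
move=> mono ij jM E nod.
have [d [df dj [Ec Ef]]] := firsts_rep (key c w a) jM.
have := nod _ df dj; rewrite leq_eqVlt => /orP[/eqP <- //|di].
move: ij; rewrite leq_eqVlt => /orP[/eqP -> //|ij].
apply: ngtw_eq; first exact: mono.
by rewrite -Ef; apply: mono; [|apply: ltn_trans jM|rewrite Ec].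
Qed.

Lemma count_le_split (s : seq nat) i j : i <= j ->
  count (leq^~ j) s = count (leq^~ i) s + count (fun d => i < d <= j) s.
Proof. by move=> ij; elim: s => //= d s ->; lia. Qed.

Lemma size_firsts_double c w K M N a : 0 < N -> a + a <= K ->
  (forall i, i < M -> c i < N) -> monotone_on c w K M ->
  (size (firsts (key c w (a + a)) M)).+1 <=
  (N * N + a) * (size (firsts (key c w a) M)).+1.
Proof.
move=> N0 aK cN mono; set D := firsts (key c w a) M; set D2 := firsts _ M.
have monoa : monotone_on c w a M by apply: monotone_le mono _; lia.
pose good i := (i + a < M) && ~~ has (fun d => i < d <= i + a) D.
pose t i := count (leq^~ i) D.
have tP i j : i <= j -> t i = t j -> forall d, d \in D -> d <= j -> d <= i.
  move=> ij; rewrite /t (count_le_split _ ij) => E d dD dj.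
  rewrite leqNgt; apply/negP => id.
  have : has (fun d => i < d <= j) D by apply/hasP; exists d => //; rewrite id.
  by rewrite has_count; lia.
(* An [i] that is not good lies at distance at most [a] before [M] or before an
   element of [D]; a good [i] is determined by the last element of [D] up to [i]
   and the colours of [i] and [i + a]. *)
have bad_le : size [seq i <- D2 | ~~ good i] <= (size D).+1 * a.
  rewrite -(size_iota 1 a) -[(size D).+1]/(size (M :: D)).
  rewrite -(size_allpairs (fun d u => d - u)).
  apply: uniq_leq_size; first by rewrite filter_uniq // firsts_uniq.
  move=> i; rewrite mem_filter => /andP[bad /firstsP[iM _]].
  apply/allpairsP; move: bad; rewrite negb_and negbK -leqNgt.
  case/orP=> [h|/hasP[d dD /andP[h1 h2]]].
    by exists (M, M - i); split; rewrite ?inE ?eqxx ?mem_iota /=; lia.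
  by exists (d, d - i); split; rewrite ?inE ?dD ?orbT ?mem_iota //=; lia.
have good_le : size [seq i <- D2 | good i] <= size D * (N * N).
  pose g i := (t i, (c i, c (i + a))).
  have := size_allpairs pair (iota 0 N) (iota 0 N).
  rewrite size_iota => <-; rewrite -(size_iota 1 (size D)).
  rewrite -(size_allpairs pair) -(size_map g).
  apply: uniq_leq_size; last first.
    move=> _ /mapP[i iG ->]; move: iG; rewrite mem_filter.
    case/andP=> /andP[iaM _] /firstsP[iM _].
    apply/allpairsP; exists (t i, (c i, c (i + a))); split=> //=.
      (* [t i] is at least 1, as the key of [i] first occurs at or before [i]; this leaves [size D]
         values. *)
      rewrite mem_iota ltnS count_size andbT -has_count.
      have [d [dD di _]] := firsts_rep (key c w a) iM.
      by apply/hasP; exists d.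
    by apply/allpairsP; exists (c i, c (i + a)); rewrite !mem_iota /= !cN.
  have uG := filter_uniq good (firsts_uniq (key c w (a + a)) M).
  rewrite map_inj_in_uniq //.
  have inj i j : i < j -> i \in [seq i <- D2 | good i] ->
      j \in [seq i <- D2 | good i] -> g i <> g j.
    move=> ij; rewrite mem_filter => /andP[/andP[iaM _] _].
    rewrite mem_filter => /andP[/andP[jaM /hasPn gj] /firstsP[jM fj]] [tij cij caij].
    apply: (fj _ ij); congr (_, _) => //; rewrite !factorD; congr (_ ++ _).
      by apply: (constant_between_firsts monoa) (tP _ _ _ tij) => //; apply: ltnW.
    (* As [j] is good, elements of [D] up to [j + a] lie at or before [j], hence at or before [i]
       because [t i = t j]. *)
    apply: (constant_between_firsts monoa) => //; first by lia.
    move=> d dD dja; have := gj _ dD; rewrite dja andbT -leqNgt => dj.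
    by apply: leq_trans (tP _ _ (ltnW ij) tij d dD dj) _; rewrite leq_addr.
  move=> i j iG jG E; case: (ltngtP i j) => // h.
    by case: (inj _ _ h iG jG).
  by case: (inj _ _ h jG iG); rewrite E.
have -> : size D2 = size [seq i <- D2 | good i] + size [seq i <- D2 | ~~ good i].
  by rewrite !(size_filter _ D2) -(count_predC good D2).
by nia.
Qed.

Lemma size_firsts1 c w M N l : (forall i, i < M -> c i < N /\ w i < l) ->
  size (firsts (key c w 1) M) <= N * l.
Proof.
move=> h; rewrite -[N](size_iota 0) -[l](size_iota 0) -(size_allpairs pair).
rewrite -(size_map (fun i => (c i, w i))); apply: uniq_leq_size; last first.
  move=> _ /mapP[i /firstsP[iM _] ->]; apply/allpairsP; exists (c i, w i).
  by rewrite !mem_iota /=; have [-> ->] := h _ iM.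
rewrite map_inj_in_uniq ?firsts_uniq // => i j /firstsP[iM fi] /firstsP[jM fj] [E1 E2].
case: (ltngtP i j) => // lt; first by case: (fj _ lt); rewrite /key /factor /= E1 E2.
by case: (fi _ lt); rewrite /key /factor /= E1 E2.
Qed.

(** Since [a] stays below [K <= N * N], each doubling costs at most the factor [2 * (N * N)]. *)
Lemma size_firsts_pow c w K M N l m : 0 < N -> 2 ^ m <= K -> K <= N * N ->
  (forall i, i < M -> c i < N /\ w i < l) -> monotone_on c w K M ->
  (size (firsts (key c w (2 ^ m)) M)).+1 <= (2 * (N * N)) ^ m * (N * l).+1.
Proof.
move=> N0 + KN cN mono; elim: m => [|m IH] mK.
  by rewrite !expn0 mul1n ltnS; apply: size_firsts1.
have mm : 2 ^ m.+1 = 2 ^ m + 2 ^ m by rewrite expnS mul2n addnn.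
have m1K : 2 ^ m + 2 ^ m <= K by rewrite -mm.
have := size_firsts_double N0 m1K (fun i iM => (cN i iM).1) mono.
rewrite -mm => /leq_trans; apply.
rewrite expnS -mulnA; apply: leq_mul; last by apply: IH; lia.
by lia.
Qed.

(** * Windows without a short period *)

Definition periodic (w : nat -> nat) i L p :=
  all (fun k => w (i + k) == w (i + k + p)) (iota 0 (L - p)).

Lemma periodicP w i L p :
  reflect (forall k, k + p < L -> w (i + k) = w (i + k + p)) (periodic w i L p).
Proof.
apply: (iffP allP) => h k kL; last by apply/eqP/h; rewrite mem_iota in kL; lia.
by apply/eqP/h; rewrite mem_iota; lia.
Qed.

(** The excluded periods [1, ..., n - 1] are the lengths of the words in [Y]. *)
Definition aperiodic w n L i := ~~ has (periodic w i L) (iota 1 n.-1).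

(** If neither suffix were greater, the shorter would be a prefix of the longer, and the difference
    of the offsets would be a period of the window starting at [x + n], which all these suffixes
    contain. *)
Lemma aperiodic_suffixes w n K x q q' : n <= K -> aperiodic w n (K - n) (x + n) ->
  q < n -> q' < n -> q != q' ->
  ~~ gtw (factor w (x + q) (K - q)) (factor w (x + q') (K - q')) ->
  gtw (factor w (x + q') (K - q')) (factor w (x + q) (K - q)).
Proof.
move=> nK ap.
have main p p' : p < p' -> p' < n ->
    ~~ gtw (factor w (x + p) (K - p)) (factor w (x + p') (K - p')) ->
    ~~ gtw (factor w (x + p') (K - p')) (factor w (x + p) (K - p)) -> False.
  move=> pp pn h1 h2; apply/(negP ap)/hasP; exists (p' - p).
    by rewrite mem_iota; lia.
  apply/periodicP => k kL.
  have := ngtw_factor h1 h2 (k := n + k - p).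
  have -> : x + p + (n + k - p) = x + n + k by lia.
  have -> : x + p' + (n + k - p) = x + n + k + (p' - p) by lia.
  by apply; lia.
move=> qn qn'; rewrite neq_ltn => /orP[lt|lt] h1; apply: contraT => h2.
  by case: (main _ _ lt qn').
by case: (main _ _ lt qn).
Qed.

Lemma drops_fun_divisible W f n : (forall j, j < n -> drops (nth 0 W) (f j) (f j.+1)) ->
  (f n).1 + (f n).2 <= size W -> 0 < (f n).2 -> n_divisible n.+1 W.
Proof.
move=> h le gt.
have lst : last (f 0) [seq f j | j <- iota 1 n] = f n.
  rewrite last_map; congr f; rewrite -nth_last size_iota.
  by case: n {h le gt} => // n; rewrite nth_iota.
apply: (@drops_divisible _ (f 0) [seq f j | j <- iota 1 n]); rewrite ?lst //.
  apply/(pathP (f 0)) => j; rewrite size_map size_iota => jn.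
  rewrite (nth_map 0) ?size_iota // nth_iota // add1n.
  rewrite -[f 0 :: _]/[seq f j | j <- iota 0 n.+1] (nth_map 0) ?size_iota; last by lia.
  by rewrite nth_iota; [apply: h | lia].
by rewrite size_map size_iota.
Qed.

Lemma repeated_divisible W n K xs : n.+1 <= K -> n < size xs -> sorted ltn xs ->
  (forall x y, x \in xs -> y \in xs -> x = y %[mod K] /\
     factor (nth 0 W) x K = factor (nth 0 W) y K) ->
  (forall x, x \in xs -> x + K <= size W /\
     aperiodic (nth 0 W) n.+1 (K - n.+1) (x + n.+1)) ->
  n_divisible n.+1 W.
Proof.
set w := nth 0 W => nK szn srt same xsW.
pose x j := nth 0 xs j.
have xin j : j <= n -> x j \in xs by move=> jn; apply: mem_nth; apply: leq_ltn_trans szn.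
(* Sorting by [r] makes the suffixes non-increasing; strictness comes later from aperiodicity. *)
pose r i j := ~~ gtw (factor w (x 0 + j) (K - j)) (factor w (x 0 + i) (K - i)).
have tot : total r.
  by move=> i j; rewrite /r -negb_and; apply/negP => /andP[/gtw_asym/negbTE ->].
set qs := sort r (iota 0 n.+1); pose q j := nth 0 qs j.
have szq : size qs = n.+1 by rewrite size_sort size_iota.
have qn j : j <= n -> q j <= n.
  move=> jn; have : q j \in qs by apply: mem_nth; rewrite szq ltnS.
  by rewrite mem_sort mem_iota; lia.
have qinj j : j < n -> q j != q j.+1.
  move=> jn; rewrite nth_uniq ?szq ?sort_uniq ?iota_uniq //; lia.
have suf a j : a <= n -> j <= n ->
    factor w (x j + a) (K - a) = factor w (x 0 + a) (K - a).
  move=> an jn; have [_] := same _ _ (xin j jn) (xin 0 (leq0n n)).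
  move/eqP/factor_eqP => E; apply/eqP/factor_eqP => k kK.
  by rewrite -!addnA E //; lia.
apply: (@drops_fun_divisible _ (fun j => (x j + q j, K - q j))) => [j jn| |] /=.
- apply/andP; split=> /=.
    have xx : x j < x j.+1 by apply: (sortedP 0 srt); apply: leq_trans szn.
    have [E _] := same _ _ (xin j (ltnW jn)) (xin _ jn).
    have := eqmod_gap xx E; have := qn _ (ltnW jn); lia.
  rewrite -/w !suf ?qn //; try lia.
  have [_ ap] := xsW _ (xin 0 (leq0n n)).
  apply: (aperiodic_suffixes nK ap); rewrite ?ltnS ?qn //; try lia.
    by rewrite eq_sym qinj.
  by apply: (sortedP 0 (sort_sorted tot _)); rewrite szq ltnS.
- have [xW _] := xsW _ (xin n (leqnn n)); have := qn _ (leqnn n); lia.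
- have := qn _ (leqnn n); lia.
Qed.

Lemma size_le_fibers (R : nat -> nat -> bool) (s D : seq nat) n :
  (forall i, i \in s -> exists2 d, d \in D & R d i) ->
  (forall d, d \in D -> count (R d) s <= n) -> size s <= n * size D.
Proof.
elim: D s => [|d D IH] s hs hD.
  by case: s hs {hD} => // i s /(_ i (mem_head _ _))[].
have := count_predC (R d) s; rewrite -(size_filter (predC (R d))).
have := hD d (mem_head _ _).
have : size (filter (predC (R d)) s) <= n * size D.
  apply: IH => [i|d' d'D].
    rewrite mem_filter => /andP[/= nR /hs[d']]; rewrite inE => /orP[/eqP ->|].
      by rewrite (negbTE nR).
    by exists d'.
  apply: leq_trans (hD d' _); last by rewrite inE d'D orbT.
  by rewrite count_filter; apply: sub_count => i /= /andP[].
rewrite [size (d :: D)]/= mulnS; lia.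
Qed.

Lemma count_aperiodic W n K (c : nat -> nat) : n.+1 <= K -> ~ n_divisible n.+1 W ->
  (forall i j, c i = c j -> i = j %[mod K]) ->
  count (aperiodic (nth 0 W) n.+1 (K - n.+1)) (iota 0 ((size W).+1 - (K - n.+1))) <=
  n.+1 * (size (firsts (key c (nth 0 W) K) ((size W).+1 - K))).+1.
Proof.
set w := nth 0 W; set M := (size W).+1 - K => nK ndiv ceq; set ap := aperiodic _ _ _.
(* The first [n + 1] windows are counted trivially; any other is the end of the factor of length [K]
   that starts [n + 1] letters earlier. *)
apply: (@leq_trans (count ap (iota 0 (n.+1 + M)))).
  have -> : n.+1 + M = (size W).+1 - (K - n.+1) + (n.+1 + M - ((size W).+1 - (K - n.+1))).
    by rewrite /M; lia.
  by rewrite iotaD count_cat leq_addr.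
rewrite iotaD count_cat mulnS leq_add //.
  by rewrite -[leqRHS](size_iota 0) count_size.
rewrite add0n -{1}[n.+1]addn0 iotaDl count_map.
rewrite -size_filter; set s := filter _ _.
apply: (@size_le_fibers (fun d i => key c w K d == key c w K i)).
  move=> i; rewrite mem_filter mem_iota => /andP[_ /andP[_ iM]].
  by have [d [dD _ /eqP E]] := firsts_rep (key c w K) iM; exists d.
move=> d _; rewrite -size_filter leqNgt; apply/negP => lt; apply: ndiv.
set xs := filter _ _ in lt.
have sub x : x \in xs -> [/\ key c w K d = key c w K x, ap (n.+1 + x) & x < M].
  rewrite mem_filter => /andP[/eqP E].
  by rewrite mem_filter mem_iota => /andP[apx /andP[_ xM]]; split.
apply: (@repeated_divisible _ _ K xs) => //; first exact: ltnW.
- by apply: sorted_filter; [exact: ltn_trans | apply: sorted_filter;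
    [exact: ltn_trans | exact: iota_ltn_sorted]].
- move=> x y /sub[E1 _ _] /sub[E2 _ _].
  by move: E2; rewrite E1 => -[/ceq].
- move=> x /sub[_ apx xM]; split; first by move: xM; rewrite /M; lia.
  by rewrite addnC.
Qed.

(** * Cutting a word into letters and periodic runs *)

Lemma representable0 Y h : representable Y h [::].
Proof. by exists [::]; split; first by apply/leP. Qed.

Lemma representableW Y h h' u : h <= h' -> representable Y h u -> representable Y h' u.
Proof. by move=> hh [ps [/leP le r]]; exists ps; split=> //; apply/leP/(leq_trans le). Qed.

Lemma representable_wpow_cat (Y : seq nat -> Prop) h y k u : Y y -> 0 < k ->
  representable Y h u -> representable Y h.+1 (wpow y k ++ u).
Proof.
move=> Yy k0 [ps [le [F ->]]]; exists ((y, k) :: ps); split=> /=; first exact: le_n_S.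
by split=> //; constructor=> //; split=> //; apply/leP.
Qed.

Lemma representable_cons (Y : seq nat -> Prop) h a u : Y [:: a] ->
  representable Y h u -> representable Y h.+1 (a :: u).
Proof. by move=> Ya; apply: (representable_wpow_cat (k := 1) Ya). Qed.

Lemma factor_wpow w i p q :
  (forall k, i <= k -> k + p < i + q * p -> w k = w (k + p)) ->
  factor w i (q * p) = wpow (factor w i p) q.
Proof.
elim: q i => [|q IH] i per //.
rewrite mulSn factorD IH => [|k ik kq]; last by apply: per; rewrite ?mulSn; lia.
rewrite /wpow /= app_cat; case: q IH per => [|q] _ per //.
congr (_ ++ List.concat (List.repeat _ _)).
apply/eqP/factor_eqP => k kp; rewrite addnAC; apply/esym/per; rewrite ?leq_addr //.
rewrite !mulSn; lia.
Qed.

Lemma maximal_run (w : nat -> nat) i p S e : e <= S ->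
  (forall k, i <= k -> k + p < e -> w k = w (k + p)) -> p <= e - i -> i <= e ->
  exists e', [/\ e <= e' <= S, e' = S \/ e' < S /\ w (e' - p) <> w e' &
    forall k, i <= k -> k + p < e' -> w k = w (k + p)].
Proof.
move=> eS; have [t] := ubnP (S - e); elim: t e eS => // t IH e eS lt per pe ie.
have [E|ne] := eqVneq e S; first by exists e; split; [rewrite leqnn | left |].
case: (w (e - p) =P w e) => [E|nE]; last by exists e; split; [rewrite leqnn | right; split=> //; lia |].
have [|||||e' [ee me pe']] := IH e.+1; try lia.
  move=> k ik; rewrite ltnS leq_eqVlt => /orP[/eqP E'|]; last exact: per.
  by rewrite E' -E -E' addnK.
by exists e'; split=> //; lia.
Qed.

(* Otherwise [w e = w (e - q) = w (e - q - p) = w (e - p)] for a period [q] of the window. *)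
Lemma aperiodic_after_run w n L i e p : 0 < p -> p < n -> n + n <= L -> i + L <= e ->
  (forall k, i <= k -> k + p < e -> w k = w (k + p)) -> w (e - p) <> w e ->
  aperiodic w n L (e.+1 - L).
Proof.
move=> p0 pn nL iL per ne; apply/negP => /hasP[q].
rewrite mem_iota => qn /periodicP perq; apply: ne.
have := perq (L.-1 - q - p); have := perq (L.-1 - q).
have -> : e.+1 - L + (L.-1 - q) = e - q by lia.
have -> : e.+1 - L + (L.-1 - q - p) = e - q - p by lia.
have -> : e - q + q = e by lia.
have -> : e - q - p + q = e - p by lia.
move=> <-; last by lia.
move=> <-; last by lia.
by rewrite (per (e - q - p)); [rewrite subnK | |]; lia.
Qed.

(** Moving the start past a counted position [x] pays for one factor. *)
Lemma count_ltn (P : pred nat) (s : seq nat) i i' x : i <= x -> x < i' -> P x -> x \in s ->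
  count (fun y => (i' <= y) && P y) s < count (fun y => (i <= y) && P y) s.
Proof.
move=> ix xi Px; elim: s => //= y s IH.
have le t : count (fun y => (i' <= y) && P y) t <= count (fun y => (i <= y) && P y) t.
  apply: sub_count => z /= /andP[iz ->]; rewrite andbT; apply: leq_trans iz.
  exact: leq_trans (ltnW xi).
have sub z : (i' <= z) && P z -> (i <= z) && P z.
  by case/andP=> iz ->; rewrite andbT; apply: leq_trans iz; apply: leq_trans (ltnW xi).
rewrite inE => /orP[/eqP <-|/IH lt]; last first.
  by rewrite -addnS leq_add //; case: ((i' <= y) && P y) (sub y) => [/(_ isT) ->|].
by rewrite ix Px (leqNgt i') xi add0n add1n ltnS le.
Qed.

(** Beyond the end the default 0 is read, which is a letter because [l] is positive. *)
Lemma nth_word_over W l i : word_over l W -> 0 < l -> nth 0 W i < l.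
Proof. by move=> Wl l0; elim: Wl i => [|y s /ltP yl _ IH] [|i] /=. Qed.

Lemma Y_set_factor W l n i a : word_over l W -> 0 < l -> 0 < a -> a < n ->
  Y_set n l (factor (nth 0 W) i a).
Proof.
move=> Wl l0 a0 an; split; last split.
- apply/List.Forall_forall => x; case/List.in_map_iff => k [<- _].
  by apply/ltP/nth_word_over.
- by case: a a0 {an}.
- by apply/ltP; rewrite -[length _]/(size _) size_factor.
Qed.

Lemma representable_letters W l n i a : word_over l W -> 0 < l -> 1 < n ->
  representable (Y_set n l) a (factor (nth 0 W) i a).
Proof.
move=> Wl l0 n1; elim: a i => [|a IH] i; first exact: representable0.
exact: representable_cons (Y_set_factor i Wl l0 (ltn0Sn 0) n1) (IH i.+1).
Qed.

(** Induction on the remaining length. The count pays for the factors before the last stretch, and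
    [L] pays for that stretch: fewer than [L] letters, possibly after one power. *)
Lemma representable_suffix W l n L i : word_over l W -> 0 < l -> 1 < n -> n + n <= L ->
  i <= size W ->
  representable (Y_set n l)
    (count (fun s => (i <= s) && aperiodic (nth 0 W) n L s)
       (iota 0 ((size W).+1 - L)) + L)
    (factor (nth 0 W) i (size W - i)).
Proof.
move=> Wl l0 n1 nL; have [t] := ubnP (size W - i); elim: t i => // t IH i lt iW.
set w := nth 0 W; set S := size W in lt iW IH *; set cnt := count _ _.
have short j h : S - j <= h -> representable (Y_set n l) h (factor w j (S - j)).
  by move=> le; apply: representableW le _; apply: representable_letters.
have [iL|iL] := ltnP S (i + L); first by apply: short; lia.
have iN : i < S.+1 - L by lia.
case: (boolP (aperiodic w n L i)) => [ap|].
  apply: (@representableW _ (count (fun s => (i.+1 <= s) && aperiodic w n L s)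
       (iota 0 (S.+1 - L)) + L).+1).
    by rewrite -addSn leq_add2r (@count_ltn _ _ _ _ i) // mem_iota.
  have -> : S - i = 1 + (S - i.+1) by lia.
  rewrite factorD addn1; apply: (@representable_cons _ _ (w i)).
    exact: (Y_set_factor i Wl l0 (ltn0Sn 0) n1).
  by apply: IH; lia.
rewrite negbK => /hasP[p]; rewrite mem_iota => pn /periodicP per.
have per0 k : i <= k -> k + p < i + L -> w k = w (k + p).
  by move=> ik kL; have := per (k - i); rewrite subnKC //; apply; lia.
have [||e [ee me pe]] := maximal_run iL per0; try lia.
(* Only whole periods are removed; the fewer than [p] remaining letters of the run are left for the
   next stage. *)
pose q := (e - i) %/ p.
have qp : e - i = q * p + (e - i) %% p := divn_eq _ _.
have rp : (e - i) %% p < p by rewrite ltn_mod; lia.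
have q0 : 0 < q by rewrite divn_gt0; lia.
have -> : S - i = q * p + (S - (i + q * p)) by lia.
rewrite factorD (factor_wpow (p := p)); last by move=> k ik kq; apply: pe; lia.
case: me => [eS|[eS ne]].
  apply: (@representableW _ L); first exact: leq_addl.
  have -> : L = L.-1.+1 by lia.
  apply: representable_wpow_cat => //; last by apply: short; lia.
  by apply: Y_set_factor => //; lia.
have ap : aperiodic w n L (e.+1 - L).
  by apply: aperiodic_after_run ne => //; try exact: pe; lia.
apply: (@representableW _ (count (fun s => (i + q * p <= s) && aperiodic w n L s)
       (iota 0 (S.+1 - L)) + L).+1).
  (* The leftover of the run is shorter than [p < n], while the window ending at the break has
     length at least [2 n]; so its start lies before [i + q * p] and leaves the count. *)
  rewrite -addSn leq_add2r; apply: (@count_ltn _ _ _ _ (e.+1 - L)) => //; try lia.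
  by rewrite mem_iota; lia.
apply: representable_wpow_cat => //; first by apply: Y_set_factor => //; lia.
by apply: IH; lia.
Qed.

(** * The explicit bound on the number of factors *)

Lemma representable_indivisible l n m W : 0 < l -> 1 < n -> 3 * n <= 2 ^ m ->
  M_set n l W ->
  representable (Y_set n l)
    (n * ((2 * ((n * 2 ^ m) * (n * 2 ^ m))) ^ m * (n * 2 ^ m * l).+1) + 2 ^ m) W.
Proof.
case: n => // n l0 n0; set K := 2 ^ m; set N := n.+1 * K; set w := nth 0 W.
move=> nK [Wl ndiv].
have K0 : 0 < K by rewrite expn_gt0.
(* [3 * n <= K] makes the window length [K - n] at least [2 * n], as the run argument requires. *)
have := representable_suffix (L := K - n.+1) Wl l0 n0 _ (leq0n _).
rewrite subn0 -/w [factor _ _ _](map_nth_iota0 0 (leqnn _)) take_size => rep.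
apply: representableW (rep _); last by lia.
apply: leq_add; last exact: leq_subr.
have wl i : w i < l by apply: nth_word_over.
pose c := color w K n.+1; set M := (size W).+1 - K.
have nc i : i < M -> ~~ chain w K n i.
  rewrite /M => iM; apply/negP => /chain_drops[p [ps [sz pth lst]]]; apply: ndiv.
  by apply: drops_divisible pth sz _ _; rewrite lst /=; lia.
have mono : monotone_on c w K M.
  by move=> i j ij jM; apply: color_mono => //; apply: nc.
have := @size_firsts_pow c w K M N l m _ (leqnn _) _ _ mono.
have ceq i j : c i = c j -> i = j %[mod K] by case/(color_eq K0).
have := count_aperiodic (K := K) _ ndiv ceq.
rewrite -/w -/M => cnt szf; apply: leq_trans (cnt _) _; first by lia.
rewrite leq_mul2l /=; apply: szf => [||i _]; rewrite ?muln_gt0 //.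
  by rewrite /N; nia.
by split; [apply: color_lt | apply: wl].
Qed.

Local Open Scope R_scope.

Lemma INR_expn a k : INR (a ^ k) = INR a ^ k.
Proof. by elim: k => // k IH; rewrite expnS -multE mult_INR IH. Qed.

Lemma exists_height l n : (1 <= l)%coq_nat -> (2 <= n)%coq_nat ->
  exists m h, 2 ^ m <= 6 * INR n /\
    INR h = INR n * ((2 * (INR n * 2 ^ m) ^ 2) ^ m * (INR n * 2 ^ m * INR l + 1))
      + 2 ^ m /\
    forall W, M_set n l W -> representable (Y_set n l) h W.
Proof.
(* [2 ^ m] is the least power of two that is at least [3 * n], hence below [6 * n]. *)
move=> /ltP l0 /ltP n1; pose m := up_log 2 (3 * n)%N; exists m.
have n3 : (1 < 3 * n)%N by lia.
have /andP[lt le] := up_log_bounds (ltnSn 1) n3.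
eexists; split; last first.
  split; last by move=> W; apply: (representable_indivisible l0 n1 le).
  rewrite plus_INR !mult_INR S_INR !mult_INR !INR_expn !mult_INR !INR_expn.
  by rewrite (_ : INR 2 = 2) // -/m; congr (_ * (_ ^ _ * _) + _); ring.
have h : (2 ^ m <= 6 * n)%N.
  have m0 : (0 < m)%N by rewrite /m up_log_gt0.
  by move: lt; rewrite -/m -{2}(prednK m0) expnS; lia.
have := le_INR _ _ (leP h).
by rewrite mult_INR INR_expn /=; move: (INR n) => x; rewrite (_ : 1 + 1 + 1 + 1 + 1 + 1 = 6); [|ring].
Qed.

End Words.

(** * Comparison with [Phi] *)

Lemma pow_bound (x L : R) (m : nat) : 2 <= x -> 1 <= L -> 2 ^ m <= 6 * x ->
  x * ((2 * (x * 2 ^ m) ^ 2) ^ m * (x * 2 ^ m * L + 1)) + 2 ^ m <=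
  2 ^ 21 * L * x ^ 10 * (x ^ 4) ^ m.
Proof.
  intros hx hL hk.
  assert (k1 : 1 <= 2 ^ m) by (apply pow_R1_Rle; lra).
  (* The base is at most [72 * x ^ 4]. Rounding 72 up to [2 ^ 7] turns the [m]-th power of the
     constant into [k ^ 7], which is at most [(6 * x) ^ 7]. *)
  assert (E : (2 ^ 7 * x ^ 4) ^ m = (2 ^ m) ^ 7 * (x ^ 4) ^ m).
  { rewrite Rpow_mult_distr, <- !pow_mult, (Nat.mul_comm 7). reflexivity. }
  set (k := 2 ^ m) in *.
  assert (X1 : 1 <= (x ^ 4) ^ m) by (apply pow_R1_Rle, pow_R1_Rle; lra).
  set (X := (x ^ 4) ^ m) in *.
  assert (xk : x * k <= 6 * x ^ 2) by nra.
  assert (base : (2 * (x * k) ^ 2) ^ m <= k ^ 7 * X).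
  { rewrite <- E. apply pow_incr. split; [nra |].
    assert ((x * k) ^ 2 <= (6 * x ^ 2) ^ 2) by (apply pow_incr; nra).
    assert (0 <= x ^ 4) by (apply pow_le; lra).
    replace ((6 * x ^ 2) ^ 2) with (36 * x ^ 4) in * by ring. lra. }
  assert (k7 : k ^ 7 <= 6 ^ 7 * x ^ 7).
  { rewrite <- Rpow_mult_distr. apply pow_incr. lra. }
  assert (x7 : 0 < x ^ 7) by (apply pow_lt; lra).
  assert (x9 : 1 <= x ^ 9) by (apply pow_R1_Rle; lra).
  assert (fac : x * k * L + 1 <= 7 * x ^ 2 * L) by nra.
  assert (main : x * ((2 * (x * k) ^ 2) ^ m * (x * k * L + 1)) <=
                 x * ((6 ^ 7 * x ^ 7 * X) * (7 * x ^ 2 * L))).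
  { apply Rmult_le_compat_l; [lra |].
    apply Rmult_le_compat; [apply pow_le; nra | nra | | exact fac].
    apply Rle_trans with (1 := base).
    apply Rmult_le_compat_r; lra. }
  assert (tail : k <= 6 * (L * x ^ 10 * X)).
  { assert (1 <= x ^ 9 * X) by nra.
    assert (1 <= L * (x ^ 9 * X)) by nra.
    replace (L * x ^ 10 * X) with (x * (L * (x ^ 9 * X))) by ring. nra. }
  assert (P : 0 <= L * x ^ 10 * X).
  { repeat apply Rmult_le_pos; lra. }
  replace (x * (6 ^ 7 * x ^ 7 * X * (7 * x ^ 2 * L)))
    with (6 ^ 7 * 7 * (L * x ^ 10 * X)) in main by ring.
  (* The constants fit because [7 * 6 ^ 7 + 6 <= 2 ^ 21]. *)
  replace (2 ^ 21 * L * x ^ 10 * X) with (2 ^ 21 * (L * x ^ 10 * X)) by ring.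
  lra.
Qed.

Lemma ln_nondecreasing (x y : R) : 0 < x -> x <= y -> ln x <= ln y.
Proof. intros hx [h | ->]; [left; apply ln_increasing; assumption | right; reflexivity]. Qed.

Lemma ln3_le_3ln2 : 0 < ln 3 <= 3 * ln 2.
Proof.
  split; [rewrite <- ln_1; apply ln_increasing; lra |].
  replace (3 * ln 2) with (ln (2 ^ 3)) by (rewrite ln_pow by lra; simpl; ring).
  apply ln_nondecreasing; lra.
Qed.

(** From [2 ^ m <= 8 * x] and [ln 3 <= 3 * ln 2] one gets [m <= 3 + 3 * log3 x], so the left side is
    at most [12 * log3 x + 22]. As [log3 x >= 1 / 3], the iterated logarithm costs at most 36 of the
    91. *)
Lemma exponent_bound (x : R) (m : nat) : 2 <= x -> 2 ^ m <= 6 * x ->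
  10 + 4 * INR m <= 12 * log3 x + 36 * log3 (log3 x) + 91.
Proof.
  intros hx hm.
  destruct ln3_le_3ln2 as [l3 l32].
  assert (lx : ln 2 <= ln x) by (apply ln_nondecreasing; lra).
  assert (ml : INR m * ln 2 <= 3 * ln 2 + ln x).
  { rewrite <- ln_pow by lra.
    replace (3 * ln 2) with (ln (2 ^ 3)) by (rewrite ln_pow by lra; simpl; ring).
    rewrite <- ln_mult by lra. apply ln_nondecreasing; [apply pow_lt |]; lra. }
  assert (L : ln x = log3 x * ln 3) by (unfold log3; field; lra).
  assert (low : 1 / 3 <= log3 x).
  { apply Rmult_le_reg_r with (ln 3); lra. }
  assert (lowlog : -1 <= log3 (log3 x)).
  { unfold log3 at 1.
    apply Rmult_le_reg_r with (ln 3); [lra |].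
    replace (ln (log3 x) / ln 3 * ln 3) with (ln (log3 x)) by (field; lra).
    replace (-1 * ln 3) with (ln (/ 3)) by (rewrite ln_Rinv by lra; ring).
    apply ln_nondecreasing; lra. }
  assert (INR m - 3 <= 3 * log3 x).
  { destruct (Rle_lt_dec (INR m) 3) as [h | h]; [lra |].
    apply Rmult_le_reg_r with (ln 3); [lra | nra]. }
  lra.
Qed.

Theorem theoremc (l n : nat) (hl : (1 <= l)%nat) (hn : (2 <= n)%nat) :
  height_at_most (M_set n l) (Y_set n l) (Phi n l).
Proof.
  destruct (Words.exists_height hl hn) as [m [h [hm [Eh rep]]]].
  exists h. split; [| exact rep].
  assert (x2 : 2 <= INR n) by (apply (le_INR 2); exact hn).
  assert (L1 : 1 <= INR l) by (apply (le_INR 1); exact hl).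
  rewrite Eh. apply Rle_trans with (1 := pow_bound _ _ _ x2 L1 hm).
  assert (E : INR n ^ 10 * (INR n ^ 4) ^ m = Rpower (INR n) (10 + 4 * INR m)).
  { rewrite <- pow_mult, <- pow_add, <- Rpower_pow by lra.
    rewrite plus_INR, mult_INR. f_equal. simpl. ring. }
  rewrite Rmult_assoc, E. unfold Phi.
  apply Rmult_le_compat; [nra | left; apply exp_pos | |].
  - apply Rmult_le_compat_r; [lra |]. apply Rle_pow; [lra |]. lia.
  - apply Rle_Rpower; [lra | apply exponent_bound; assumption].
Qed.
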